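(* Let $n\ge 1$, let $\mathcal{M}=\mathbb{S}_{++}^n$, and map every tangent vector $\xi\in T_{\Sigma}\mathcal{M}$ ($\Sigma\in\mathcal{M}$) to $\xi' := \Sigma^{-1/2}\,\xi\,\Sigma^{-1/2}$, equivalently $\xi=\Sigma^{1/2}\,\xi'\,\Sigma^{1/2}$. Then the operators on $\mathcal{M}$, expressed in terms of mapped tangent vectors (as defined in the context), satisfy the following. (1) Metric: for all $\Sigma\in\mathcal{M}$ and all mapped tangent vectors $\xi',\eta'$ at $\Sigma$, $g'_{\Sigma}(\xi',\eta')=\mathrm{tr}(\xi'\eta')$. (2) Gradient: for every differentiable $f$ and every $\Sigma\in\mathcal{M}$, $\nabla' f(\Sigma)=\tfrac12\,\Sigma^{1/2}\big(\nabla_E f(\Sigma)+(\nabla_E f(\Sigma))^{\top}\big)\Sigma^{1/2}$. (3) Vector transport: for all $\Sigma_1,\Sigma_2\in\mathcal{M}$ and all mapped tangent vectors $\xi'$ at $\Sigma_1$, $\mathcal{T}'_{\Sigma_1,\Sigma_2}(\xi')=\xi'$. (4) Exponential map: $\mathrm{Exp}_{\Sigma}(\xi')=\Sigma^{1/2}\exp(\xi')\,\Sigma^{1/2}$. (5) Adjoint vector transport: the defining relation of the adjoint is preserved, i.e. for all $\Sigma_1,\Sigma_2\in\mathcal{M}$, all $\xi'\in T_{\Sigma_1}\mathcal{M}$ and all $\eta'\in T_{\Sigma_2}\mathcal{M}$, $g'_{\Sigma_1}(\xi',\mathcal{T}'^{*}_{\Sigma_1,\Sigma_2}\eta')=g'_{\Sigma_2}(\mathcal{T}'_{\Sigma_1,\Sigma_2}\xi',\eta')$.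 (6) Retraction: the second-order approximate retraction becomes $\mathrm{Ret}_{\Sigma}(\xi')=\Sigma+\Sigma^{1/2}\xi'\Sigma^{1/2}+\tfrac12\,\Sigma^{1/2}\xi'^{\,2}\,\Sigma^{1/2}$.
   Context: $\mathcal{M}=\mathbb{S}_{++}^n$ is the manifold of real symmetric positive definite $n\times n$ matrices; for each $\Sigma\in\mathcal{M}$ the tangent space $T_\Sigma\mathcal{M}$ is identified with the space of real symmetric $n\times n$ matrices. $\Sigma^{1/2}$ is the symmetric positive definite square root, $\Sigma^{-1/2}$ its inverse, $\exp$ of a matrix is the matrix exponential, and $\mathrm{tr}$ is the trace. Unmapped operators, for $\xi,\eta\in T_\Sigma\mathcal{M}$: metric $g_\Sigma(\xi,\eta)=\mathrm{tr}(\Sigma^{-1}\xi\Sigma^{-1}\eta)$; Riemannian gradient $\nabla f(\Sigma)=\tfrac12\Sigma\big(\nabla_E f(\Sigma)+(\nabla_E f(\Sigma))^\top\big)\Sigma$, where $\nabla_E f(\Sigma)\in\mathbb{R}^{n\times n}$ is the Euclidean gradient of the real-valued function $f$; exponential map $\mathrm{Exp}_\Sigma(\xi)=\Sigma\exp(\Sigma^{-1}\xi)=\Sigma^{1/2}\exp(\Sigma^{-1/2}\xi\Sigma^{-1/2})\Sigma^{1/2}$; vector transport $\mathcal{T}_{\Sigma_1,\Sigma_2}(\xi)=\Sigma_2^{1/2}\Sigma_1^{-1/2}\,\xi\,\Sigma_1^{-1/2}\Sigma_2^{1/2}$ for $\xi\in T_{\Sigma_1}\mathcal{M}$, with values in $T_{\Sigma_2}\mathcal{M}$;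 adjoint vector transport $\mathcal{T}^*_{\Sigma_1,\Sigma_2}:T_{\Sigma_2}\mathcal{M}\to T_{\Sigma_1}\mathcal{M}$, defined by $g_{\Sigma_1}(\xi,\mathcal{T}^*_{\Sigma_1,\Sigma_2}\eta)=g_{\Sigma_2}(\mathcal{T}_{\Sigma_1,\Sigma_2}\xi,\eta)$ for all $\xi\in T_{\Sigma_1}\mathcal{M}$, $\eta\in T_{\Sigma_2}\mathcal{M}$; approximate (second-order Taylor) retraction $\mathrm{Ret}_\Sigma(\xi)=\Sigma+\xi+\tfrac12\xi\Sigma^{-1}\xi$. Operators after the mapping are the same operators read in terms of mapped vectors. A primed tangent vector at $\Sigma$ denotes the image under the mapping at $\Sigma$ of the corresponding unprimed one. Thus $g'_\Sigma(\xi',\eta'):=g_\Sigma(\xi,\eta)$; $\nabla' f(\Sigma)$ is the image of $\nabla f(\Sigma)$ under the mapping at $\Sigma$; $\mathcal{T}'_{\Sigma_1,\Sigma_2}(\xi')$ is the image under the mapping at $\Sigma_2$ of $\mathcal{T}_{\Sigma_1,\Sigma_2}(\xi)$; $\mathcal{T}'^{*}_{\Sigma_1,\Sigma_2}(\eta')$ is the image under the mapping at $\Sigma_1$ of $\mathcal{T}^*_{\Sigma_1,\Sigma_2}(\eta)$; and $\mathrm{Exp}_\Sigma(\xi')$, $\mathrm{Ret}_\Sigma(\xi')$ denote $\mathrm{Exp}_\Sigma(\xi)$, $\mathrm{Ret}_\Sigma(\xi)$ expressed as functions of $\xi'$. *)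

(* Defs.v *)
From HB Require Import structures.
From mathcomp Require Import all_boot all_order all_algebra.
From mathcomp Require Import all_classical all_reals all_analysis.

Set Implicit Arguments.
Unset Strict Implicit.
Unset Printing Implicit Defensive.

Import Order.TTheory GRing.Theory Num.Theory.
Import numFieldNormedType.Exports.

Local Open Scope classical_set_scope.
Local Open Scope ring_scope.

Section SPDManifold.
Context {R : realType} {n : nat}.
Implicit Types (S A xi eta : 'M[R]_n) (f : 'M[R]_n -> R).

Definition spd : set 'M[R]_n :=
  [set S | S \is symmetricmx /\
           forall x : 'cV[R]_n, x != 0 -> 0 < (x^T *m S *m x) 0 0].

(* Under the usual identification, the tangent space does not depend on the
   base point [S]; the argument is kept to track where a vector is attached. *)
Definition tangent S : set 'M[R]_n := [set xi | xi \is symmetricmx].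

(* The positive definite square root, selected by choice.  The default value 0
   is only reached when [S] has none, i.e. when [S] is not in [spd]. *)
Definition sqrtmx S : 'M[R]_n := xget 0 [set A | spd A /\ A *m A = S].

Definition isqrtmx S : 'M[R]_n := invmx (sqrtmx S).

(* The limit is taken for the entrywise (normed) topology on matrices. *)
Definition expmx A : 'M[R]_n :=
  limn (series (fun k : nat => (k`!%:R^-1 : R) *: A ^+ k)).

Definition metric S xi eta : R := \tr (invmx S *m xi *m invmx S *m eta).

(* The functions considered are defined on the ambient matrix space, so the
   partial derivatives are taken with respect to all n^2 entries and the
   resulting matrix need not be symmetric. *)
Definition egrad f S : 'M[R]_n := \matrix_(i, j) 'D_(delta_mx i j) f S.

Definition rgrad f S : 'M[R]_n :=
  2^-1 *: (S *m (egrad f S + (egrad f S)^T) *m S).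

Definition Exp S xi : 'M[R]_n := S *m expmx (invmx S *m xi).

Definition transport S1 S2 xi : 'M[R]_n :=
  sqrtmx S2 *m isqrtmx S1 *m xi *m isqrtmx S1 *m sqrtmx S2.

(* The tangent vector at [S1] determined by the defining relation of the
   adjoint; it is unique because [metric S1] is nondegenerate on tangent
   vectors. *)
Definition adjtransport S1 S2 eta : 'M[R]_n :=
  xget 0 [set zeta | tangent S1 zeta /\
    forall xi, tangent S1 xi ->
      metric S1 xi zeta = metric S2 (transport S1 S2 xi) eta].

Definition Ret S xi : 'M[R]_n := S + xi + 2^-1 *: (xi *m invmx S *m xi).

Definition tmap S xi : 'M[R]_n := isqrtmx S *m xi *m isqrtmx S.
Definition tunmap S xi' : 'M[R]_n := sqrtmx S *m xi' *m sqrtmx S.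

Definition mtangent S : set 'M[R]_n := tmap S @` tangent S.

Definition metric' S xi' eta' : R := metric S (tunmap S xi') (tunmap S eta').

Definition rgrad' f S : 'M[R]_n := tmap S (rgrad f S).

Definition transport' S1 S2 xi' : 'M[R]_n :=
  tmap S2 (transport S1 S2 (tunmap S1 xi')).

Definition adjtransport' S1 S2 eta' : 'M[R]_n :=
  tmap S1 (adjtransport S1 S2 (tunmap S2 eta')).

Definition Exp' S xi' : 'M[R]_n := Exp S (tunmap S xi').

Definition Ret' S xi' : 'M[R]_n := Ret S (tunmap S xi').

End SPDManifold.

(* Main.v *)
Require Import Defs.
From HB Require Import structures.
From mathcomp Require Import all_boot all_order all_algebra.
From mathcomp Require Import all_classical all_reals all_analysis.
From mathcomp.real_closed Require Import complex.
Set Implicit Arguments.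
Unset Strict Implicit.
Unset Printing Implicit Defensive.
Import Order.TTheory GRing.Theory Num.Theory.
Import numFieldNormedType.Exports.
Local Open Scope classical_set_scope.
Local Open Scope ring_scope.

(** Write A for the selected positive definite square root of S.  The mapping at S is
    the congruence xi |-> A^-1 xi A^-1 and its inverse is xi' |-> A xi' A.
    Once A is known to exist, to be symmetric and invertible, and to satisfy
    A A = S, each operator in mapped form is obtained by cancelling factors
    A A^-1.  Three points are not mere cancellation.

    Existence of A ([spd_sqrt_exists]).  The operator [sqrtmx] selects A by
    choice, so nothing can be said of it before some positive definite root is
    produced.  Over R[i] the spectral theorem diagonalizes S with real
    eigenvalues, which positive definiteness makes positive; hence every real
    polynomial vanishing on this finite set of positive numbers kills S
    ([spd_annihilator]).  Let q be a real polynomial interpolating the fourth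
    root on that set: then B = q(S) is symmetric because S is, and B^4 = S
    because q^4 - X vanishes on the set.  The matrix A = B B = B^T B is then a
    square root of S, and it is positive definite because B is invertible.  Taking a fourth root instead of a square root
    gives positivity of A without a second look at eigenvalues.

    The exponential ([expmx_conj]).  From S^-1 (A xi' A) = A^-1 xi' A, the
    exponential map is S exp(A^-1 xi' A), and the exponential commutes with
    conjugation since it is the limit of a series: the partial sums are
    conjugated termwise, and conjugation is continuous.  This needs the series
    to converge ([expmx_cvg]), because the limit of a divergent series is an
    arbitrary value.

    The adjoint transport is also selected by choice, so its defining relation
    has to be shown satisfiable ([adjtransportP]).  In mapped coordinates every
    transport is the identity and every metric is the trace form, so the
    transport in the opposite direction is an adjoint. *)

(** * Square roots of positive definite matrices *)

Lemma symmetricmxE (F : fieldType) (n : nat) (A : 'M[F]_n) :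
  (A \is symmetricmx) = (A^T == A).
Proof.
by rewrite is_hermitianmxE expr0 scale1r map_mx_id // eq_sym.
Qed.

(** Newton's scheme: a new node a is accommodated by adding a multiple of the
    product of the X - c over the old nodes c, which leaves the values at the
    old nodes unchanged. *)
Lemma interpolation (F : fieldType) (s : seq F) (f : F -> F) :
  exists p : {poly F}, {in s, forall a, p.[a] = f a}.
Proof.
elim: s => [|a s [p ps]]; first by exists 0.
have [a_s|a_s] := boolP (a \in s).
  by exists p => b; rewrite inE => /predU1P[->|]; exact: ps.
pose q : {poly F} := \prod_(c <- s) ('X - c%:P).
have qa : q.[a] != 0 by rewrite -rootE root_prod_XsubC.
exists (p + ((f a - p.[a]) / q.[a]) *: q) => b.
rewrite !hornerE inE; case/predU1P => [->|b_s].
  by rewrite divfK // addrC subrK.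
have /rootP -> : root q b by rewrite root_prod_XsubC.
by rewrite mulr0 addr0 ps.
Qed.

Lemma tr_horner_mx (F : comNzRingType) (n : nat) (A : 'M[F]_n.+1)
    (p : {poly F}) :
  (horner_mx A p)^T = horner_mx A^T p.
Proof.
elim/poly_ind: p => [|p c IH]; first by rewrite !rmorph0 trmx0.
rewrite !(rmorphD, rmorphM) /= !horner_mx_X !horner_mx_C.
rewrite linearD /= tr_scalar_mx.
congr (_ + _); rewrite [LHS]trmx_mul IH.
exact: (comm_mx_horner _ (comm_mx_refl _)).
Qed.

Section SpdSquareRoot.
Context {R : realType}.

(** If v S = a v then v S v^T = a (v v^T), and the left-hand side is positive
    while v v^T is a sum of squares. *)
Lemma spd_eigenvalue_gt0 (n : nat) (S : 'M[R]_n) (a : R) :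
  spd S -> eigenvalue S a -> 0 < a.
Proof.
move=> [_ Spos] /eigenvalueP[v vS v0].
have := Spos v^T; rewrite trmx_eq0 => /(_ v0); rewrite trmxK vS -scalemxAl mxE.
apply: contraTT; rewrite -!leNgt => a0; apply: mulr_le0_ge0 => //.
by rewrite mxE sumr_ge0 // => i _; rewrite mxE -expr2 sqr_ge0.
Qed.

Lemma spd_unitmx (n : nat) (S : 'M[R]_n) : spd S -> S \in unitmx.
Proof.
move=> Sspd; rewrite -row_free_unit -kermx_eq0.
apply/rowV0P => v /sub_kermxP vS.
apply/eqP; apply/negPn/negP => v0.
suff : (0 : R) < 0 by rewrite ltxx.
apply: (spd_eigenvalue_gt0 Sspd); apply/eigenvalueP.
by exists v => //; rewrite vS scale0r.
Qed.

(** The diagonalizability of S over the reals, in the form in which it is used: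
    the set s is the spectrum, and a polynomial of S depends only on the values
    taken on s.  The diagonalization itself is carried out over R[i], where the
    characteristic polynomial splits; the result descends to R since the
    eigenvalues are real and real matrices embed in complex ones. *)
Lemma spd_annihilator (n : nat) (S : 'M[R]_n.+1) : spd S ->
  exists2 s : seq R, {in s, forall a, 0 < a} &
    forall p : {poly R}, {in s, forall a, root p a} -> horner_mx S p = 0.
Proof.
move=> Sspd; have [Ssym _] := Sspd.
pose toC : {rmorphism R -> R[i]} := real_complex R; pose SC := map_mx toC S.
have SCreal : SC \is a mxOver Num.real.
  by apply/mxOverP => i j; rewrite mxE; apply/complex_realP; eexists.
have SCsym : SC \is symmetricmx.
  by move: Ssym; rewrite !symmetricmxE map_trmx => /eqP ->.
have /orthomx_spectralP := symmetric_normalmx SCsym SCreal.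
have /mxOverP dreal :=
  hermitian_spectral_diag_real (realsym_hermsym SCsym SCreal).
have := spectral_unit SC.
move: (spectralmx SC) (spectral_diag SC) dreal => P d dreal Punit SCE.
have dE i : d 0 i = toC (complex.Re (d 0 i)).
  exact/esym/RRe_real/dreal.
exists [seq complex.Re (d 0 i) | i <- enum 'I_n.+1].
  move=> _ /mapP[i _ ->]; apply: (spd_eigenvalue_gt0 Sspd).
  rewrite eigenvalue_root_char -(fmorph_root toC) map_char_poly -dE.
  rewrite -/SC -eigenvalue_root_char; apply/eigenvalueP.
  (* The rows of the diagonalizing matrix are the left eigenvectors. *)
  exists (delta_mx 0 i *m P).
    rewrite SCE !mulmxA mulmxK // -(rowE i (diag_mx d)) row_diag_mx.
    by rewrite -scalemxAl.
  rewrite mulmx_free_eq0 ?row_free_unit //; apply/eqP => /matrixP/(_ 0 i).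
  by rewrite !mxE !eqxx => /eqP; rewrite oner_eq0.
move=> p ps; apply: (map_mx_inj (f := toC)).
rewrite [LHS]map_horner_mx [map_mx _ _]SCE horner_mx_uconjC // horner_mx_diag.
rewrite map_mx0 [map_mx _ d](_ : _ = 0) ?linear0 ?mulmx0 ?mul0mx //.
apply/matrixP => j i; rewrite !mxE ord1 dE; apply/eqP.
rewrite horner_map (rootP (ps _ _)) ?rmorph0 //.
by apply/mapP; exists i; rewrite ?mem_enum.
Qed.

(** A polynomial of S that takes the value of the fourth root at each
    eigenvalue; being a polynomial of S makes it real and symmetric. *)
Lemma spd_fourth_root (n : nat) (S : 'M[R]_n.+1) : spd S ->
  exists2 B : 'M[R]_n.+1, B \is symmetricmx & B ^+ 4 = S.
Proof.
move=> Sspd; have [Ssym _] := Sspd.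
have [s s_gt0 s_ann] := spd_annihilator Sspd.
have [q qs] := interpolation s (fun a => Num.sqrt (Num.sqrt a)).
exists (horner_mx S q).
  by move: Ssym; rewrite !symmetricmxE tr_horner_mx => /eqP ->.
apply/eqP; rewrite -subr_eq0 -rmorphXn -[X in _ - X]horner_mx_X -rmorphB.
apply/eqP/s_ann => a a_s; rewrite rootE !hornerE qs //.
have a0 := s_gt0 _ a_s.
by rewrite (exprM _ 2 2) !sqr_sqrtr ?sqrtr_ge0 ?ltW // subrr.
Qed.

(** The square of a symmetric fourth root B is positive definite, because
    x^T B B x = (B x)^T (B x) is a sum of squares, not all zero when x is
    nonzero since B is invertible. *)
Lemma spd_sqrt_exists (n : nat) (S : 'M[R]_n) : spd S ->
  exists A : 'M[R]_n, spd A /\ A *m A = S.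
Proof.
case: n S => [|n] S Sspd.
  by exists S; split=> //; rewrite [LHS]flatmx0 [RHS]flatmx0.
have [B /[!symmetricmxE]/eqP Bsym B4] := spd_fourth_root Sspd.
exists (B *m B); split; last by rewrite -B4 !exprS expr0 mulr1 -!mulmxE !mulmxA.
split; first by rewrite symmetricmxE trmx_mul Bsym.
move=> x x0.
have Bunit : B \in unitmx.
  by have := spd_unitmx Sspd; rewrite -B4 exprS unitmx_mul => /andP[].
rewrite -{1}Bsym mulmxA -trmx_mul -mulmxA.
have Bx0 : B *m x != 0.
  by apply: contra_neq x0 => Bx; rewrite -(mulKmx Bunit x) Bx mulmx0.
rewrite mxE lt_def sumr_ge0 ?andbT; last first.
  by move=> i _; rewrite mxE -expr2 sqr_ge0.
apply: contra_neq Bx0 => /eqP.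
rewrite psumr_eq0; last by move=> i _; rewrite mxE -expr2 sqr_ge0.
move=> /allP Bx0; apply/matrixP => i j; rewrite ord1.
have := Bx0 i; rewrite mem_index_enum => /(_ isT) /=.
by rewrite mxE mulf_eq0 orbb => /eqP ->; rewrite mxE.
Qed.

End SpdSquareRoot.

(** * The matrix exponential *)

Section MatrixExponential.
Context {R : realType}.

Lemma cvg_mx_entries (m n : nat) (T : Type) (F : set_system T) {FF : Filter F}
    (u : T -> 'M[R]_(m, n)) (l : 'M[R]_(m, n)) :
  (forall i j, (fun t => u t i j) @ F --> l i j) -> u @ F --> l.
Proof.
move=> ul; apply/cvg_ballP => e e0.
apply: (filterS (P := fun t => forall i, forall j, ball (l i j) e (u t i j))).
  by move=> t lu; split.
apply: filter_forall => i; apply: filter_forall => j.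
by move/cvg_ballP: (ul i j); apply.
Qed.

Lemma cvg_mulmx2 (m n p q : nat) (T : Type) (F : set_system T) {FF : Filter F}
    (P : 'M[R]_(m, n)) (Q : 'M[R]_(p, q))
    (u : T -> 'M[R]_(n, p)) (l : 'M[R]_(n, p)) :
  u @ F --> l -> (fun t => P *m u t *m Q) @ F --> P *m l *m Q.
Proof.
move=> ul; apply: cvg_mx_entries => i j.
have ulE a b : (fun t => u t a b) @ F --> l a b.
  exact: (cvg_comp u (fun M : 'M[R]_(n, p) => M a b) ul
            (@coord_continuous _ _ _ a b l)).
rewrite mxE; under eq_fun do rewrite mxE.
apply: cvg_big => [|k _]; first exact: add_continuous.
apply: cvgMr_tmp; rewrite mxE; under eq_fun do rewrite mxE.
by apply: cvg_big => [|a _]; [exact: add_continuous | exact: cvgMl_tmp].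
Qed.

(** The sum of the absolute values of all entries is a submultiplicative bound
    that dominates each entry, which makes the induction immediate (the largest
    absolute value would bring in a power of n). *)
Lemma exprmx_entry_le (n : nat) (A : 'M[R]_n) (k : nat) (i j : 'I_n) :
  `|(A ^+ k) i j| <= (\sum_a \sum_b `|A a b|) ^+ k.
Proof.
set s := \sum_a _.
have s0 : 0 <= s by rewrite !sumr_ge0 // => a _; rewrite sumr_ge0.
elim: k i j => [|k IH] i j.
  by rewrite !expr0 mxE; case: (_ == _); rewrite ?normr1 ?normr0.
rewrite !exprS mxE (le_trans (ler_norm_sum _ _ _)) //.
apply: (@le_trans _ _ ((\sum_b `|A i b|) * s ^+ k)).
  by rewrite mulr_suml ler_sum // => b _; rewrite normrM ler_wpM2l.
rewrite ler_wpM2r ?exprn_ge0 // [leRHS](bigD1 i) //= lerDl.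
by rewrite sumr_ge0 // => a _; rewrite sumr_ge0.
Qed.

(** Entry by entry, the series is dominated by the series of the real
    exponential at the sum s of the absolute values of the entries of A. *)
Lemma expmx_cvg (n : nat) (A : 'M[R]_n) :
  series (fun k : nat => (k`!%:R^-1 : R) *: A ^+ k) @ \oo --> expmx A.
Proof.
pose u i j k := k`!%:R^-1 * (A ^+ k) i j.
have ucvg i j : cvgn (series (u i j)).
  apply: normed_cvg; set s := \sum_a \sum_b `|A a b|.
  have s0 : 0 <= s by rewrite !sumr_ge0 // => a _; rewrite sumr_ge0.
  apply: (series_le_cvg _ _ _ (is_cvg_series_exp_coeff s)) => k.
  - exact: normr_ge0.
  - exact: exp_coeff_ge0.
  rewrite /u /exp_coeff /= normrM normfV normr_nat mulrC ler_wpM2r ?invr_ge0 //.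
  exact: exprmx_entry_le.
suff : series (fun k : nat => (k`!%:R^-1 : R) *: A ^+ k) @ \oo -->
    (\matrix_(i, j) limn (series (u i j))) by exact: cvgP.
apply: cvg_mx_entries => i j; rewrite mxE.
rewrite [X in X @ _ --> _](_ : _ = series (u i j)); first exact: ucvg.
apply/funext => N; rewrite /series /= summxE.
by apply: eq_bigr => k _; rewrite mxE.
Qed.

Lemma expmx_conj (n : nat) (P A : 'M[R]_n) : P \in unitmx ->
  expmx (invmx P *m A *m P) = invmx P *m expmx A *m P.
Proof.
move=> Pu; apply: cvg_lim; first exact: norm_hausdorff.
set u := series _.
suff -> : u = (fun N => invmx P *m
    series (fun k : nat => (k`!%:R^-1 : R) *: A ^+ k) N *m P).
  by apply: cvg_mulmx2; exact: expmx_cvg.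
apply/funext => N; rewrite /u.
rewrite /series /= mulmx_sumr mulmx_suml; apply: eq_bigr => k _.
rewrite -scalemxAr -scalemxAl; congr (_ *: _).
elim: k => [|k IH]; first by rewrite !expr0 mulmx1 mulVmx.
by rewrite !exprS IH -!mulmxE !mulmxA mulmxK.
Qed.

End MatrixExponential.

(** * Operators in mapped coordinates *)

Section MappedOperators.
Context {R : realType} {n : nat}.
Implicit Types (S xi eta : 'M[R]_n).

Lemma sqrtmxP S : spd S -> spd (sqrtmx S) /\ sqrtmx S *m sqrtmx S = S.
Proof. by move=> /spd_sqrt_exists; exact: xgetPex. Qed.

Lemma sqrtmx_unit S : spd S -> sqrtmx S \in unitmx.
Proof. by move=> /sqrtmxP[/spd_unitmx]. Qed.

Lemma tr_sqrtmx S : spd S -> (sqrtmx S)^T = sqrtmx S.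
Proof. by case/sqrtmxP => -[/[!symmetricmxE]/eqP]. Qed.

Lemma invmx_sqrt S : spd S -> invmx S = isqrtmx S *m isqrtmx S.
Proof.
move=> Sspd; have Au := sqrtmx_unit Sspd.
rewrite -[RHS](mulKmx (spd_unitmx Sspd)) -[X in _ *m (X *m _)](sqrtmxP Sspd).2.
by rewrite /isqrtmx -mulmxA mulKVmx // mulmxV // mulmx1.
Qed.

Lemma tunmapK S : spd S -> cancel (tunmap S) (tmap S).
Proof.
move=> /sqrtmx_unit Au xi.
by rewrite /tmap /tunmap /isqrtmx !mulmxA mulVmx // mul1mx mulmxK.
Qed.

Lemma tmapK S : spd S -> cancel (tmap S) (tunmap S).
Proof.
move=> /sqrtmx_unit Au xi.
by rewrite /tmap /tunmap /isqrtmx !mulmxA mulmxV // mul1mx mulmxKV.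
Qed.

(** Tangency does not depend on the base point, so the point S' at which xi is
    attached is arbitrary; a mapped vector is symmetric as well. *)
Lemma tunmap_tangent S S' xi : spd S ->
  tangent S' xi -> tangent S (tunmap S xi).
Proof.
rewrite /tangent /= !symmetricmxE => Sspd /eqP xiT.
by rewrite /tunmap !trmx_mul tr_sqrtmx // xiT mulmxA.
Qed.

Lemma tmap_tangent S S' xi : spd S -> tangent S' xi -> tangent S (tmap S xi).
Proof.
rewrite /tangent /= !symmetricmxE => Sspd /eqP xiT.
by rewrite /tmap /isqrtmx !trmx_mul trmx_inv tr_sqrtmx // xiT mulmxA.
Qed.

(** Since S^-1 = A^-1 A^-1, moving one factor A^-1 around the trace turns the
    metric into the trace form of the mapped vectors: the mapping is an
    isometry onto the symmetric matrices with the Frobenius product. *)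
Lemma metricE S xi eta : spd S ->
  metric S xi eta = \tr (tmap S xi *m tmap S eta).
Proof.
move=> Sspd; rewrite /metric invmx_sqrt // /tmap -!mulmxA mxtrace_mulC.
by rewrite -!mulmxA.
Qed.

(** The transport is the identity read through the two mappings; the statements
    on the transport and on its adjoint follow from this. *)
Lemma transportE S1 S2 xi : transport S1 S2 xi = tunmap S2 (tmap S1 xi).
Proof. by rewrite /transport /tunmap /tmap !mulmxA. Qed.

(** The transport in the opposite direction satisfies the defining relation: in
    mapped coordinates both sides are the trace form of the same vectors. *)
Lemma adjtransportP S1 S2 eta : spd S1 -> spd S2 -> tangent S2 eta ->
  forall xi, tangent S1 xi ->
    metric S1 xi (adjtransport S1 S2 eta) = metric S2 (transport S1 S2 xi) eta.
Proof.
move=> S1spd S2spd eta_sym.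
have [] // := @xgetPex _ 0 [set zeta | tangent S1 zeta /\
    forall xi, tangent S1 xi ->
      metric S1 xi zeta = metric S2 (transport S1 S2 xi) eta].
exists (transport S2 S1 eta); split.
  rewrite transportE; apply: (tunmap_tangent (S' := S2)) => //.
  exact: tmap_tangent eta_sym.
by move=> xi _; rewrite !metricE // !transportE !tunmapK.
Qed.

End MappedOperators.

Theorem proposition1 (R : realType) (n : nat) (n_ge1 : (1 <= n)%N) :
  [/\ (* the two forms of the mapping are equivalent *)
      forall S xi xi' : 'M[R]_n, spd S -> tangent S xi ->
        (xi' = isqrtmx S *m xi *m isqrtmx S <->
         xi = sqrtmx S *m xi' *m sqrtmx S),
      (* metric *)
      forall S xi' eta' : 'M[R]_n,
        spd S -> mtangent S xi' -> mtangent S eta' ->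
        metric' S xi' eta' = \tr (xi' *m eta'),
      (* gradient *)
      forall f : 'M[R]_n -> R,
        (forall S : 'M[R]_n, spd S -> differentiable f S) ->
        forall S : 'M[R]_n, spd S ->
        rgrad' f S =
          2^-1 *: (sqrtmx S *m (egrad f S + (egrad f S)^T) *m sqrtmx S),
      (* vector transport *)
      forall S1 S2 xi' : 'M[R]_n,
        spd S1 -> spd S2 -> mtangent S1 xi' ->
        transport' S1 S2 xi' = xi'
    & [/\ (* exponential map *)
          forall S xi' : 'M[R]_n, spd S -> mtangent S xi' ->
            Exp' S xi' = sqrtmx S *m expmx xi' *m sqrtmx S,
          (* adjoint vector transport *)
          forall S1 S2 xi' eta' : 'M[R]_n,
            spd S1 -> spd S2 -> mtangent S1 xi' -> mtangent S2 eta' ->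
            metric' S1 xi' (adjtransport' S1 S2 eta') =
            metric' S2 (transport' S1 S2 xi') eta'
        & (* retraction *)
          forall S xi' : 'M[R]_n, spd S -> mtangent S xi' ->
            Ret' S xi' = S + sqrtmx S *m xi' *m sqrtmx S
              + 2^-1 *: (sqrtmx S *m (xi' ^+ 2) *m sqrtmx S)]].
Proof.
split; [| | | | split].
- move=> S xi xi' Sspd _; rewrite -/(tmap S xi) -/(tunmap S xi').
  by split=> ->; rewrite ?tmapK ?tunmapK.
- by move=> S xi' eta' Sspd _ _; rewrite /metric' metricE // !tunmapK.
- move=> f _ S Sspd; rewrite /rgrad' /rgrad.
  rewrite -[RHS](tunmapK Sspd); congr tmap.
  rewrite /tunmap -scalemxAr -scalemxAl.
  by rewrite -{1 4}(sqrtmxP Sspd).2 !mulmxA.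
- by move=> S1 S2 xi' S1spd S2spd _; rewrite /transport' transportE !tunmapK.
- move=> S xi' Sspd _; have Au := sqrtmx_unit Sspd.
  rewrite /Exp' /Exp.
  have -> : invmx S *m tunmap S xi' = isqrtmx S *m xi' *m sqrtmx S.
    by rewrite invmx_sqrt // /tunmap !mulmxA /isqrtmx mulmxKV.
  rewrite /isqrtmx expmx_conj // -{1}(sqrtmxP Sspd).2 !mulmxA.
  by rewrite mulmxK.
- move=> S1 S2 _ _ S1spd S2spd [xi xi_sym <-] [eta eta_sym <-].
  rewrite /metric' /adjtransport' /transport' !tmapK //.
  exact: adjtransportP.
- move=> S xi' Sspd _; have Au := sqrtmx_unit Sspd.
  rewrite /Ret' /Ret; congr (_ + _ + _ *: _).
  rewrite invmx_sqrt // /tunmap /isqrtmx expr2 -mulmxE !mulmxA.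
  by rewrite mulmxKV // mulmxK.
Qed.
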